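(* Let $p>2$, $0<\lambda<\Lambda$, and let $B_1(0)\subset\mathbb{R}^n$ be the open unit ball. There exist positive constants $\delta=\delta(\lambda,\Lambda,n)$ and $M=M(\lambda,\Lambda,n,p)$ such that the following holds. Let $u_0\in C^1(\overline{B_1(0)})$ be a radial function with $u_0\ge0$ and $u_0=0$ on $\partial B_1(0)$, written $u_0=u_0(r)$, $r=|x|$. If $$\int_\delta^{1-\delta}u_0(r)\,dr>M,$$ then the viscosity solution $u$ of $$u_t-\mathcal{M}^-(D^2u)=|Du|^p\ \text{ in }B_1(0)\times(0,\infty),\qquad u=0\ \text{ on }\partial B_1(0)\times(0,\infty),\qquad u(\cdot,0)=u_0\ \text{ in }\overline{B_1(0)},$$ where the boundary condition is understood in the viscosity sense, has loss of boundary conditions at some finite time $T=T(u_0)$.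
   Context: $S(n)$ denotes the real symmetric $n\times n$ matrices with the usual ordering. For $0<\lambda<\Lambda$ and $X\in S(n)$, Pucci's minimal operator is $\mathcal{M}^-(X)=\inf\{\mathrm{tr}(AX): A\in S(n),\ \lambda I\le A\le\Lambda I\}$. With $\Omega=B_1(0)$, a viscosity solution of the problem is a continuous function $u$ on $\overline\Omega\times[0,\infty)$ which is a viscosity solution of the equation in $\Omega\times(0,\infty)$, satisfies $u(\cdot,0)=u_0$ pointwise on $\overline\Omega$, and satisfies $u=0$ on $\partial\Omega\times(0,\infty)$ in the viscosity sense, that is: at points of $\partial\Omega\times(0,\infty)$, $$\min\big(u_t-\mathcal{M}^-(D^2u)-|Du|^p,\,u\big)\le 0\quad\text{and}\quad \max\big(u_t-\mathcal{M}^-(D^2u)-|Du|^p,\,u\big)\ge 0$$ hold in the viscosity sense (the first with derivatives replaced by those of any smooth test function touching $u$ from above at the point relative to $\overline\Omega\times(0,\infty)$, the second with those of any smooth test function touching $u$ from below). It is known that there is a unique globally defined continuous viscosity solution. Loss of boundary conditions (LOBC) occurs when $u=0$ on the lateral boundary fails in the classical (pointwise) sense; LOBC at time $T$ means that $u(x,T)\ne0$ for some $x\in\partial\Omega$. *)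

(* Defs.v *)
From HB Require Import structures.
From mathcomp Require Import all_boot all_order all_algebra.
From mathcomp Require Import all_classical all_reals all_analysis.
Set Implicit Arguments.
Unset Strict Implicit.
Unset Printing Implicit Defensive.
Import Order.TTheory GRing.Theory Num.Theory.
Import numFieldNormedType.Exports.
Local Open Scope classical_set_scope.
Local Open Scope ring_scope.

(** Points of R^n are row vectors.  The library norm on ['rV[R]_n] is the
    sup norm; it induces the usual topology, but the balls and the gradient
    term of the equation need the Euclidean norm. *)
Definition enorm (R : realType) (n : nat) (x : 'rV[R]_n) : R :=
  Num.sqrt (\sum_(i < n) x 0 i ^+ 2).

Definition uball (R : realType) (n : nat) : set 'rV[R]_n :=
  [set x | enorm x < 1].
Definition cl_uball (R : realType) (n : nat) : set 'rV[R]_n :=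
  [set x | enorm x <= 1].
Definition usphere (R : realType) (n : nat) : set 'rV[R]_n :=
  [set x | enorm x = 1].

(** [C^1] of the closed unit ball: continuous there, with first partial
    derivatives in the open ball extending continuously to the closed ball. *)
Definition C1_cl_uball (R : realType) (n : nat) (f : 'rV[R]_n -> R) : Prop :=
  {within cl_uball (R := R) (n := n), continuous f} /\
  forall i : 'I_n, exists g : 'rV[R]_n -> R,
    {within cl_uball (R := R) (n := n), continuous g} /\
    forall x, uball x ->
      derivable f x (delta_mx 0 i) /\ 'D_(delta_mx 0 i) f x = g x.

Definition loewner_le (R : realType) (n : nat) (A B : 'M[R]_n) : Prop :=
  forall v : 'rV[R]_n, (v *m A *m v^T) 0 0 <= (v *m B *m v^T) 0 0.

Definition pucci_min (R : realType) (n : nat) (lambda Lambda : R)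
    (X : 'M[R]_n) : R :=
  inf [set \tr (A *m X) | A in [set A : 'M[R]_n |
    [/\ A^T = A, loewner_le lambda%:M A & loewner_le A Lambda%:M]]].

(** Pairs [(x, t)]; time is [R^o], i.e. [R] as a normed module over itself. *)
Definition spacetime (R : realType) (n : nat) : normedModType R :=
  ('rV[R]_n * R^o)%type.

Definition e_t (R : realType) (n : nat) : spacetime R n :=
  ((0 : 'rV[R]_n), (1 : R^o)).
Definition e_x (R : realType) (n : nat) (i : 'I_n) : spacetime R n :=
  ((delta_mx 0 i : 'rV[R]_n), (0 : R^o)).

Definition dt (R : realType) (n : nat) (phi : spacetime R n -> R)
    (z : spacetime R n) : R :=
  'D_(e_t R n) phi z.
Definition grad (R : realType) (n : nat) (phi : spacetime R n -> R)
    (z : spacetime R n) : 'rV[R]_n :=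
  \row_i 'D_(e_x R i) phi z.
Definition hess (R : realType) (n : nat) (phi : spacetime R n -> R)
    (z : spacetime R n) : 'M[R]_n :=
  \matrix_(i, j) 'D_(e_x R i) ('D_(e_x R j) phi) z.

(** Meant for open [U]. *)
Fixpoint Ck_on (R : realType) (V : normedModType R) (U : set V) (k : nat)
    (phi : V -> R) {struct k} : Prop :=
  (forall z, U z -> {for z, continuous phi}) /\
  match k with
  | 0%N => True
  | k'.+1 => forall v : V,
      (forall z, U z -> derivable phi z v) /\ Ck_on U k' ('D_v phi)
  end.

Definition smooth_near (R : realType) (V : normedModType R) (phi : V -> R)
    (z : V) : Prop :=
  exists U : set V, [/\ open U, U z & forall k, Ck_on U k phi].

Definition touches_above (R : realType) (V : normedModType R) (S : set V)
    (u phi : V -> R) (z : V) : Prop :=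
  phi z = u z /\ \forall y \near z, S y -> u y <= phi y.
Definition touches_below (R : realType) (V : normedModType R) (S : set V)
    (u phi : V -> R) (z : V) : Prop :=
  phi z = u z /\ \forall y \near z, S y -> phi y <= u y.

Definition pde_op (R : realType) (n : nat) (lambda Lambda p : R)
    (phi : spacetime R n -> R) (z : spacetime R n) : R :=
  dt phi z - pucci_min lambda Lambda (hess phi z) - enorm (grad phi z) `^ p.

Definition cyl (R : realType) (n : nat) : set (spacetime R n) :=
  [set z | uball z.1 /\ 0 < z.2].
Definition cl_cyl (R : realType) (n : nat) : set (spacetime R n) :=
  [set z | cl_uball z.1 /\ 0 < z.2].
Definition lateral (R : realType) (n : nat) : set (spacetime R n) :=
  [set z | usphere z.1 /\ 0 < z.2].
Definition cl_cyl0 (R : realType) (n : nat) : set (spacetime R n) :=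
  [set z | cl_uball z.1 /\ 0 <= z.2].

Definition visc_eq_interior (R : realType) (n : nat) (lambda Lambda p : R)
    (u : spacetime R n -> R) : Prop :=
  forall z, cyl z -> forall phi : spacetime R n -> R, smooth_near phi z ->
    (touches_above (@cyl R n) u phi z -> pde_op lambda Lambda p phi z <= 0) /\
    (touches_below (@cyl R n) u phi z -> 0 <= pde_op lambda Lambda p phi z).

Definition visc_bc (R : realType) (n : nat) (lambda Lambda p : R)
    (u : spacetime R n -> R) : Prop :=
  forall z, lateral z -> forall phi : spacetime R n -> R, smooth_near phi z ->
    (touches_above (@cl_cyl R n) u phi z ->
      Num.min (pde_op lambda Lambda p phi z) (u z) <= 0) /\
    (touches_below (@cl_cyl R n) u phi z ->
      0 <= Num.max (pde_op lambda Lambda p phi z) (u z)).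

(** Only the values of [u] on the closed cylinder [cl_cyl0] matter. *)
Definition viscosity_solution (R : realType) (n : nat) (lambda Lambda p : R)
    (u0 : 'rV[R]_n -> R) (u : spacetime R n -> R) : Prop :=
  [/\ {within @cl_cyl0 R n, continuous u},
      visc_eq_interior lambda Lambda p u,
      forall x, cl_uball x -> u (x, 0) = u0 x &
      visc_bc lambda Lambda p u].

Definition LOBC_at (R : realType) (n : nat) (u : spacetime R n -> R) (T : R)
    : Prop :=
  exists x : 'rV[R]_n, usphere x /\ u (x, T) <> 0.

(* Main.v *)
Require Import Defs.
From HB Require Import structures.
From mathcomp Require Import all_boot all_order all_algebra.
From mathcomp Require Import all_classical all_reals all_analysis.
From mathcomp Require Import ring lra.
Import Order.TTheory GRing.Theory Num.Theory.
Import numFieldNormedType.Exports.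
Local Open Scope classical_set_scope.
Local Open Scope ring_scope.

(** A large integral of the radial profile yields one point [x0 = r0 e], with
[e] a coordinate vector and [1/4 <= r0 <= 3/4], at which the initial datum
exceeds a constant [A0] that depends on [lambda], [Lambda], [n] and [p] alone
([Rintegral_gt_exists]). One such value is enough. The equation is the dynamic
programming equation of a control problem in which a drift of size [m] costs
a multiple of [m^q] with [q = p/(p-1)]. As [p > 2], [q < 2], and a diffusion can
then be steered to a prescribed point in a prescribed time at finite cost: a
bridge has a drift of size [s^(-1/2)] at time [s] before the arrival, and
[s^(-q/2)] is integrable. Hence a high value of the datum, however narrow the
peak that carries it, forces [u] to be large at a fixed later time, even at the
boundary, because starting from a boundary point and moving inwards has a
finite cost too.

This heuristic becomes an explicit strict subsolution, the [barrier]
   [A(t) - k(t) |x - g(t) e|^2],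
a paraboloid whose vertex [g(t) e] travels from [x0] at time [0] to the boundary
point [e] at time [T]. Its opening is
   [k(t) = kappa ((eta + t)^(-a) + (T - t)^(-a))]
with [a < 1], so that it is positive only on a small ball around [x0] at time
[0], as small as the peak of the datum requires when [eta] tends to [0], and
only on a ball inside the domain when the vertex is close to the boundary. The
gradient term absorbs both the widening of the paraboloid and the motion of the
vertex ([opening_absorb], [transport_absorb]), at the price of a decrease of
the height [A] at the rate [k], up to constants. As [a < 1], that rate is
integrable uniformly in [eta], and the choice of a small [T] and then of a
large [A0] keeps [A] above [A0 / 4] on [0, T) ([height_ge]).

Suppose that [u] vanishes on the whole lateral boundary. The barrier is
nonpositive there and below the datum at time [0], so it stays below [u]
([strict_subsolution_le], [barrier_le_solution]). Along the vertex this gives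
[u >= A0 / 4] up to time [T], and by continuity [u (e, T) > 0]
([boundary_value_gt0]), which is a contradiction. *)

(** * Smoothness of functions of space and time *)

Lemma continuous_at_near_eq {R : realType} {V : normedModType R} (f g : V -> R)
    (z : V) :
  (\forall y \near z, f y = g y) -> {for z, continuous f} ->
  {for z, continuous g}.
Proof.
move=> fg cf; rewrite /prop_for /continuous_at -(nbhs_singleton fg).
by apply: cvg_trans cf; apply: near_eq_cvg.
Qed.

(** The class only sees the values on [U], so derivatives may be computed by
    formulas that hold on [U] only. *)
Lemma Ck_on_eq {R : realType} {V : normedModType R} (U : set V) (k : nat)
    (f g : V -> R) :
  open U -> (forall z, U z -> f z = g z) -> Ck_on U k f -> Ck_on U k g.
Proof.
move=> oU; elim: k f g => [|k IH] f g fg /= [cf df].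
  split=> // z Uz; apply: continuous_at_near_eq (cf z Uz).
  by apply: filterS (open_nbhs_nbhs (conj oU Uz)) => y; exact: fg.
have fgn z : U z -> \forall y \near z, f y = g y.
  by move=> Uz; apply: filterS (open_nbhs_nbhs (conj oU Uz)) => y; exact: fg.
split=> [z Uz|v]; first exact: continuous_at_near_eq (fgn z Uz) (cf z Uz).
have [dfv Cfv] := df v; split=> [z Uz|].
  exact: near_eq_derivable (fgn z Uz) (dfv z Uz).
apply: IH Cfv => z Uz; exact: near_eq_derive (fgn z Uz).
Qed.

Lemma Ck_onW {R : realType} {V : normedModType R} (U : set V) (k : nat)
    (f : V -> R) : Ck_on U k.+1 f -> Ck_on U k f.
Proof.
elim: k f => [|k IH] f /= [cf df]; first by [].
by split=> // v; have [dv Cv] := df v; split=> //; apply: IH.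
Qed.

Lemma Ck_on_cst {R : realType} {V : normedModType R} (U : set V) (k : nat)
    (c : R) : Ck_on U k (fun=> c).
Proof.
elim: k c => [|k IH] c /=.
  by split=> // z _; exact: cst_continuous.
split=> [z _|v]; first exact: cst_continuous.
split=> [z _|]; first exact: derivable_cst.
have -> : 'D_v (fun=> c : R) = (fun=> 0 : R) by apply/funext => z; exact: derive_cst.
exact: IH.
Qed.

Lemma Ck_onD {R : realType} {V : normedModType R} (U : set V) (k : nat)
    (f g : V -> R) :
  open U -> Ck_on U k f -> Ck_on U k g -> Ck_on U k (fun z => f z + g z).
Proof.
move=> oU; elim: k f g => [|k IH] f g /= [cf df] [cg dg].
  by split=> // z Uz; apply: continuousD; [exact: cf|exact: cg].
split=> [z Uz|v]; first by apply: continuousD; [exact: cf|exact: cg].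
have [dfv Cfv] := df v; have [dgv Cgv] := dg v; split=> [z Uz|].
  by apply: derivableD; [exact: dfv|exact: dgv].
apply: (Ck_on_eq _ _ (fun z => 'D_v f z + 'D_v g z)) => // [z Uz|].
  by rewrite deriveD //; [exact: dfv|exact: dgv].
exact: IH.
Qed.

Lemma Ck_onM {R : realType} {V : normedModType R} (U : set V) (k : nat)
    (f g : V -> R) :
  open U -> Ck_on U k f -> Ck_on U k g -> Ck_on U k (fun z => f z * g z).
Proof.
move=> oU; elim: k f g => [|k IH] f g Cf Cg.
  case: Cf Cg => cf df [cg dg].
  by split=> // z Uz; apply: continuousM; [exact: cf|exact: cg].
have [Cf' Cg'] := (Ck_onW _ _ _ Cf, Ck_onW _ _ _ Cg).
case: Cf Cg => cf df [cg dg].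
split=> [z Uz|v]; first by apply: continuousM; [exact: cf|exact: cg].
have [dfv Cfv] := df v; have [dgv Cgv] := dg v; split=> [z Uz|].
  by apply: derivableM; [exact: dfv|exact: dgv].
apply: (Ck_on_eq _ _ (fun z => f z * 'D_v g z + g z * 'D_v f z)) => // [z Uz|].
  by rewrite deriveM //; [exact: dfv|exact: dgv].
by apply: Ck_onD => //; apply: IH.
Qed.

Lemma Ck_on_exp {R : realType} {V : normedModType R} (U : set V) (k m : nat)
    (f : V -> R) : open U -> Ck_on U k f -> Ck_on U k (fun z => f z ^+ m).
Proof.
move=> oU Cf; elim: m => [|m IH].
  by under eq_fun do rewrite expr0; exact: Ck_on_cst.
by under eq_fun do rewrite exprS; exact: Ck_onM.
Qed.

Lemma Ck_on_sum {R : realType} {V : normedModType R} (I : Type) (r : seq I)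
    (U : set V) (k : nat) (f : I -> V -> R) :
  open U -> (forall i, Ck_on U k (f i)) -> Ck_on U k (fun z => \sum_(i <- r) f i z).
Proof.
move=> oU Cf; elim: r => [|i r IH].
  by under eq_fun do rewrite big_nil; exact: Ck_on_cst.
by under eq_fun do rewrite big_cons; exact: Ck_onD.
Qed.

Lemma is_derive_coord {R : realType} {n : nat} (i : 'I_n) (z v : spacetime R n) :
  is_derive z v (fun z : spacetime R n => z.1 0 i : R) (v.1 0 i).
Proof.
have H : (fun h : R => h^-1 *: ((((h *: v + z).1) 0 i : R) - z.1 0 i)) @ 0^' -->
    (v.1 0 i : R).
  apply: cvg_near_cst; near=> h.
  have h0 : h != 0 by near: h; exact: nbhs_dnbhs_neq.
  by rewrite /= !mxE addrK scalerA mulVf ?scale1r.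
by apply: DeriveDef; [apply/cvg_ex; exists (v.1 0 i)|apply/cvg_lim].
Unshelve. all: by end_near. Qed.

Lemma is_derive_dir {R : realType} (a : R -> R) (t w a' : R) :
  is_derive t 1 a a' -> is_derive t w a (w * a').
Proof.
move=> ha.
have da : differentiable a t by apply/derivable1_diffP; case: ha.
apply: DeriveDef; first exact: diff_derivable.
rewrite deriveE // -[X in 'd _ _ X](mulr1 w).
have -> : 'd a t (w * 1) = w *: 'd a t 1 by rewrite -linearZ.
by rewrite -deriveE //; case: ha => _ ->.
Qed.

(** The difference quotients of a function of time in the direction [v] are
    those of [a] at the step [v.2]. *)
Lemma is_derive_time {R : realType} {n : nat} (a : R -> R) (a' : R)
    (z v : spacetime R n) :
  is_derive (z.2 : R) 1 a a' ->
  is_derive z v (fun z : spacetime R n => a z.2) (v.2 * a').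
Proof.
move=> /(is_derive_dir a _ v.2); case: z => x t; case: v => y w /= [h1 h2].
by apply: DeriveDef.
Qed.

Lemma is_derive_time0 {R : realType} {n : nat} (a : R -> R)
    (z : spacetime R n) (i : 'I_n) :
  is_derive z (e_x R i) (fun z : spacetime R n => a z.2) 0.
Proof.
have H : (fun h : R => h^-1 *: (a (h *: e_x R i + z).2 - a z.2)) @ 0^' -->
    (0 : R).
  by apply: cvg_near_cst; near=> h; rewrite /= scaler0 add0r subrr scaler0.
by apply: DeriveDef; [apply/cvg_ex; exists 0|apply/cvg_lim].
Unshelve. all: by end_near. Qed.

Lemma continuous_coord {R : realType} {n : nat} (i : 'I_n) :
  continuous (fun z : spacetime R n => z.1 0 i : R).
Proof.
move=> z; apply: (cvg_comp fst (fun x : 'rV[R]_n => x 0 i)); first exact: cvg_fst.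
exact: coord_continuous.
Qed.

Lemma Ck_on_coord {R : realType} {n : nat} (U : set (spacetime R n)) (k : nat)
    (i : 'I_n) : open U -> Ck_on U k (fun z : spacetime R n => z.1 0 i : R).
Proof.
move=> oU; case: k => [|k] /=.
  by split=> // z _; exact: continuous_coord.
split=> [z _|v]; first exact: continuous_coord.
split=> [z _|]; first by case: (is_derive_coord i z v).
apply: (Ck_on_eq _ _ (fun=> v.1 0 i : R)) => // [z _|]; last exact: Ck_on_cst.
by case: (is_derive_coord i z v) => _ ->.
Qed.

(** Powers of affine functions of time form a family that is stable under
    differentiation, up to constant factors. *)
Lemma Ck_on_powR_time {R : realType} {n : nat} (U : set (spacetime R n))
    (k : nat) (c d b : R) :
  open U -> (forall z, U z -> 0 < c + d * z.2) ->
  Ck_on U k (fun z : spacetime R n => (c + d * z.2) `^ b).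
Proof.
move=> oU pU.
have D b' (z v : spacetime R n) : U z ->
    is_derive z v (fun z : spacetime R n => (c + d * z.2) `^ b')
      (v.2 * (b' * (c + d * z.2) `^ (b' - 1) * d)).
  move=> Uz; apply: (is_derive_time (fun t => (c + d * t) `^ b')).
  apply: (is_derive1_comp (f := fun s => s `^ b') (g := fun t => c + d * t)).
    exact: is_derive1_powR (pU z Uz).
  have := is_deriveD (is_derive_cst c (z.2 : R) 1)
    (is_deriveZ d (is_derive_id (z.2 : R) 1)).
  by rewrite add0r -[d%:A]/(d * 1) mulr1.
have cont b' z : U z ->
    {for z, continuous (fun z : spacetime R n => (c + d * z.2) `^ b')}.
  move=> Uz.
  have [/derivable1_diffP/differentiable_continuous cp _] :=
    is_derive1_powR b' (pU z Uz).
  apply: (cvg_comp (fun z : spacetime R n => c + d * z.2)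
    (fun s : R => s `^ b') _ cp).
  by apply: cvgD; [exact: cvg_cst|apply: cvgM; [exact: cvg_cst|exact: cvg_snd]].
elim: k b => [|k IH] b /=.
  by split=> // z Uz; exact: cont.
split=> [z Uz|v]; first exact: cont.
split=> [z Uz|]; first by case: (D b z v Uz).
apply: (Ck_on_eq _ _ (fun z => v.2 * b * d * (c + d * z.2) `^ (b - 1))) => //.
  by move=> z Uz; case: (D b z v Uz) => _ ->; ring.
by apply: Ck_onM => //; exact: Ck_on_cst.
Qed.

(** * Comparison with strict subsolutions *)

(** Subtracting a function of time changes neither the gradient nor the
    Hessian in space: the spatial difference quotients are the same. *)
Lemma derive_x_sub_time {R : realType} {n : nat} (phi : spacetime R n -> R)
    (g : R -> R) (i : 'I_n) :
  'D_(e_x R i) (fun z => phi z - g z.2) = 'D_(e_x R i) phi.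
Proof.
apply/funext => z; rewrite /derive.
rewrite (_ : (fun h => _) = (fun h : R =>
  h^-1 *: ((phi \o shift z) (h *: e_x R i) - phi z))) //.
by apply/funext => h /=; rewrite scaler0 add0r opprB addrA subrK.
Qed.

Lemma pde_op_sub_time {R : realType} {n : nat} (lambda Lambda p : R)
    (phi : spacetime R n -> R) (g : R -> R) (g' : R) (z : spacetime R n) :
  derivable phi z (e_t R n) -> is_derive (z.2 : R) 1 g g' ->
  pde_op lambda Lambda p (fun z => phi z - g z.2) z =
  pde_op lambda Lambda p phi z - g'.
Proof.
move=> dphi dg; rewrite /pde_op.
have -> : grad (fun z => phi z - g z.2) z = grad phi z.
  by apply/rowP => i; rewrite !mxE; exact: (congr1 (@^~ z) (derive_x_sub_time phi g i)).
have -> : hess (fun z => phi z - g z.2) z = hess phi z.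
  apply/matrixP => i j; rewrite mxE [RHS]mxE.
  exact: (congr1 (fun f => 'D_(e_x R i) f z) (derive_x_sub_time phi g j)).
have -> : dt (fun z => phi z - g z.2) z = dt phi z - g'.
  have [dg1 dg2] := is_derive_time g g' z (e_t R n) dg.
  by rewrite /dt deriveB // dg2 /= mul1r.
by rewrite -!addrA; congr (_ + _); rewrite addrC !addrA.
Qed.

Lemma smooth_near_sub_time {R : realType} {n : nat} (phi : spacetime R n -> R)
    (g : R -> R) (z : spacetime R n) :
  (forall (U : set (spacetime R n)) k, open U ->
     Ck_on U k (fun z : spacetime R n => g z.2)) ->
  smooth_near phi z -> smooth_near (fun z => phi z - g z.2) z.
Proof.
move=> Cg [U [oU Uz Cphi]]; exists U; split=> // k.
apply: Ck_onD => //.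
apply: (Ck_on_eq _ _ (fun z : spacetime R n => -1 * g z.2)) => //.
  by move=> y _; rewrite mulN1r.
by apply: Ck_onM => //; [exact: Ck_on_cst|exact: Cg].
Qed.

Lemma Ck_on_time {R : realType} {n : nat} (U : set (spacetime R n)) (k : nat) :
  open U -> Ck_on U k (fun z : spacetime R n => z.2 : R).
Proof.
move=> oU; have cont (z : spacetime R n) :
  {for z, continuous (fun z : spacetime R n => z.2 : R)} by exact: cvg_snd.
case: k => [|k] /=; first by split=> // z _.
have D (z v : spacetime R n) : is_derive z v (fun z : spacetime R n => z.2 : R)
    (v.2 * 1).
  by apply: (is_derive_time id); exact: is_derive_id.
split=> [z _|v]; first exact: cont.
split=> [z _|]; first by case: (D z v).
apply: (Ck_on_eq _ _ (fun=> v.2 : R)) => // [z _|]; last exact: Ck_on_cst.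
by case: (D z v) => _ ->; rewrite mulr1.
Qed.

Lemma continuous_enorm {R : realType} {n : nat} :
  continuous (fun x : 'rV[R]_n => enorm x).
Proof.
move=> x.
have [c _] : Ck_on setT 0 (fun y : 'rV[R]_n => \sum_(i < n) y 0 i ^+ 2).
  apply: Ck_on_sum => [|i]; first exact: openT.
  apply: Ck_on_exp; first exact: openT.
  by split=> // y _; exact: coord_continuous.
exact: (cvg_comp _ Num.sqrt (c x I) (@sqrt_continuous R _)).
Qed.

Lemma ler_coord_enorm {R : realType} {n : nat} (x : 'rV[R]_n) (i : 'I_n) :
  `|x 0 i| <= enorm x.
Proof.
rewrite -sqrtr_sqr ler_sqrt ?sumr_ge0 // => [|j _]; last exact: sqr_ge0.
by rewrite (bigD1 i) //= lerDl sumr_ge0 // => j _; exact: sqr_ge0.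
Qed.

Lemma compact_cl_uball {R : realType} {n : nat} : compact (@cl_uball R n).
Proof.
apply: bounded_closed_compact.
  exists 1; split=> // M M1 x /= x1.
  apply: le_trans (ltW M1); rewrite -[`|x|]/(mx_norm x) mx_normrE.
  apply: (big_ind (fun r => r <= 1)) => [//|a b a1 b1|[j i] _ /=]; first by rewrite ge_max a1 b1.
  by rewrite ord1 (le_trans (ler_coord_enorm x i)).
rewrite (_ : @cl_uball R n = (@enorm R n) @^-1` [set r | r <= 1]) //.
by apply: closed_comp => [x _|]; [exact: continuous_enorm|exact: closed_le].
Qed.

(** A maximum of [phi - u] over the compact cylinder may sit at the final
    time, where [phi] does not touch [u] from below in a full neighbourhood.
    Subtracting the increasing function [B (t / T) ^ m], which is small at
    the time of the assumed violation and large at time [T], moves the maximum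
    to an earlier time, and makes a strict subsolution only stricter. *)
Lemma strict_subsolution_le {R : realType} {n : nat} (lambda Lambda p : R)
    (u phi : spacetime R n -> R) (T : R) :
  0 < T -> {within @cl_cyl0 R n, continuous u} ->
  visc_eq_interior lambda Lambda p u ->
  (forall z : spacetime R n, cl_uball z.1 -> 0 <= z.2 <= T -> {for z, continuous phi}) ->
  (forall x, cl_uball x -> phi (x, 0) <= u (x, 0)) ->
  (forall (x : 'rV[R]_n) (t : R), usphere x -> 0 < t <= T -> phi (x, t) <= u (x, t)) ->
  (forall z, cyl z -> z.2 <= T -> u z < phi z ->
    smooth_near phi z /\ pde_op lambda Lambda p phi z < 0) ->
  forall z : spacetime R n, cl_uball z.1 -> 0 <= z.2 < T -> phi z <= u z.
Proof.
move=> T0 cu su cphi phi_init phi_lat strict z1 z1b /andP[z10 z1T].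
rewrite leNgt; apply/negP => viol.
pose K : set (spacetime R n) := @cl_uball R n `*` `[0, T]%classic.
have Kcompact : compact K.
  by apply: compact_setX; [exact: compact_cl_uball|exact: segment_compact].
have KE (z : spacetime R n) : K z <-> cl_uball z.1 /\ 0 <= z.2 <= T.
  by rewrite /K /setX /= in_itv.
have Kz1 : K z1 by apply/KE; rewrite z10 ltW.
pose F (z : spacetime R n) := phi z - u z.
have cF : {within K, continuous F}.
  have cu' : {within K, continuous u}.
    apply: continuous_subspaceW cu => z /KE[zb /andP[z0 _]]; by split.
  have cp' : {within K, continuous phi}.
    apply: continuous_in_subspaceT => z; rewrite inE => /KE[zb zt].
    exact: cphi.
  by move=> z; apply: cvgB; [exact: cp'|exact: cu'].
have [c0 _ c0max] := compact_EVT_max (ex_intro _ z1 Kz1) Kcompact cF.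
pose B := F c0.
have FB z : K z -> F z <= B by move=> Kz; apply: c0max; rewrite inE.
have Fz1 : 0 < F z1 by rewrite subr_gt0.
have B0 : 0 < B by exact: lt_le_trans Fz1 (FB _ Kz1).
have [m Bm] : exists m : nat, B * (z1.2 / T) ^+ m < F z1.
  have q1 : `|z1.2 / T| < 1.
    by rewrite ger0_norm ?divr_ge0 ?(ltW T0)// ltr_pdivrMr // mul1r.
  have /cvgrPdist_lt/(_ _ Fz1) [k _ Hk] := cvg_geometric B q1.
  exists k; have := Hk k (leqnn _).
  rewrite /= sub0r normrN; exact: le_lt_trans (ler_norm _).
pose g (t : R) := B * (t / T) ^+ m.
have cg : continuous (fun z : spacetime R n => g z.2).
  move=> z; apply: cvgM; first exact: cvg_cst.
  apply: (cvg_comp (fun z : spacetime R n => z.2 / T) (fun s : R => s ^+ m)).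
    by apply: cvgM; [exact: cvg_snd|exact: cvg_cst].
  exact: exprn_continuous.
have cG : {within K, continuous (fun z => F z - g z.2)}.
  have cg' : {within K, continuous (fun z : spacetime R n => g z.2)}.
    exact: continuous_subspaceT.
  by move=> z; apply: cvgB; [exact: cF|exact: cg'].
have [z2] := compact_EVT_max (ex_intro _ z1 Kz1) Kcompact cG.
rewrite inE => Kz2 z2max.
pose M := F z2 - g z2.2.
have GM z : K z -> F z - g z.2 <= M by move=> Kz; apply: z2max; rewrite inE.
have M0 : 0 < M by apply: lt_le_trans (GM _ Kz1); rewrite subr_gt0.
have /KE[z2b /andP[z20 z2T]] := Kz2.
have g0 : 0 <= g z2.2 by rewrite mulr_ge0 ?exprn_ge0 ?divr_ge0 // ltW.
have Fz2 : 0 < F z2.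
  by apply: lt_le_trans M0 _; rewrite lerBlDr lerDl.
have z2pos : 0 < z2.2.
  rewrite lt_neqAle z20 andbT eq_sym; apply/eqP => z2e.
  have := phi_init z2.1 z2b; rewrite -z2e -surjective_pairing -subr_le0 => h.
  by move: Fz2; rewrite ltNge h.
have z2u : cyl z2.
  split=> //; rewrite /uball /= lt_neqAle; apply/andP; split; last exact: z2b.
  apply/eqP => z2s; have := phi_lat z2.1 z2.2 z2s.
  rewrite z2pos z2T -surjective_pairing -subr_le0 => /(_ isT) h.
  by move: Fz2; rewrite ltNge h.
have z2ltT : z2.2 < T.
  rewrite lt_neqAle z2T andbT; apply/eqP => z2e.
  move: M0; rewrite /M z2e /g divff ?gt_eqF // expr1n mulr1 subr_gt0.
  by rewrite ltNge FB.
have [smphi neg] : smooth_near phi z2 /\ pde_op lambda Lambda p phi z2 < 0.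
  by apply: strict => //; rewrite -subr_gt0.
pose h (t : R) := g t + M.
have dh : is_derive (z2.2 : R) 1 h (B * (m%:R * (z2.2 / T) ^+ m.-1 * T^-1)).
  have d1 := is_deriveX m (is_deriveZ T^-1 (is_derive_id (z2.2 : R) 1)).
  have := is_deriveD (is_deriveZ B d1) (is_derive_cst M (z2.2 : R) 1).
  rewrite (_ : _ + _ = h); last first.
    by apply/funext => t; rewrite /h /g !fctE /= -![_ *: _]/(_ * _) (mulrC t).
  move=> dh; apply: (is_derive_eq dh).
  by rewrite addr0 /= -![_ *: _]/(_ * _) mulr1 [T^-1 * _]mulrC.
have Ch (U : set (spacetime R n)) k : open U ->
    Ck_on U k (fun z : spacetime R n => h z.2).
  move=> oU; apply: Ck_onD => //; last exact: Ck_on_cst.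
  apply: Ck_onM => //; first exact: Ck_on_cst.
  apply: Ck_on_exp => //; apply: Ck_onM => //; last exact: Ck_on_cst.
  exact: Ck_on_time.
have [_ sup] := su z2 z2u (fun z => phi z - h z.2)
  (smooth_near_sub_time phi h z2 Ch smphi).
have dphi : derivable phi z2 (e_t R n).
  by have [U [_ Uz2 CU]] := smphi; have [_ /(_ (e_t R n))[+ _]] := CU 1%N; exact.
have : 0 <= pde_op lambda Lambda p (fun z => phi z - h z.2) z2.
  apply: sup; split; first by rewrite /h /M /F; ring.
  have : \forall y \near z2, y.2 < T.
    have c2 : {for z2, continuous (fun z : spacetime R n => z.2 : R)}.
      exact: cvg_snd.
    exact: (cvgr_lt _ c2).
  apply: filterS => y yT [yb y0].
  have : F y - g y.2 <= M.
    by apply: GM; apply/KE; rewrite (ltW y0) (ltW yT); split=> //; exact: ltW.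
  by rewrite /F /h; lra.
rewrite (pde_op_sub_time _ _ _ _ _ _ _ dphi dh) leNgt subr_lt0.
rewrite (lt_le_trans neg) //.
by rewrite !(mulr_ge0, invr_ge0, ler0n, exprn_ge0, divr_ge0, ltW B0, ltW T0).
Qed.

(** * Moving paraboloids *)

(** For a nonpositive multiple of the identity the infimum is governed by the
    upper ellipticity bound: the diagonal entries of an admissible [A] are at
    most [Lambda]. *)
Lemma pucci_min_scalar_ge {R : realType} {n : nat} (lambda Lambda c : R) :
  lambda <= Lambda -> 0 <= c ->
  - (c * n%:R * Lambda) <= pucci_min lambda Lambda (- c%:M : 'M[R]_n).
Proof.
move=> lL c0; apply: lb_le_inf.
  exists (\tr (lambda%:M *m (- c%:M : 'M[R]_n))).
  exists lambda%:M => //; split=> [|v|v]; rewrite ?tr_scalar_mx //.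
  rewrite !mul_mx_scalar -!scalemxAl !mxE ler_wpM2r //.
  by rewrite sumr_ge0 // => i _; rewrite !mxE -expr2 sqr_ge0.
move=> _ [A [_ _ AL] <-].
have -> : \tr (A *m - c%:M) = - (c * \tr A).
  by rewrite mulmxN mul_mx_scalar raddfN /= mxtraceZ.
rewrite lerN2 -mulrA ler_wpM2l //.
rewrite /mxtrace mulr_natl -[X in _ *+ X]card_ord -sumr_const ler_sum // => i _.
have := AL (delta_mx 0 i).
rewrite -rowE trmx_delta -colE mul_mx_scalar -scalemxAl -rowE !mxE eqxx.
by rewrite mulr1.
Qed.

(** [g] is the position of the moving vertex on the axis [i0]. *)
Definition sqdist {R : realType} {n : nat} (g : R -> R) (i0 : 'I_n)
    (z : spacetime R n) : R :=
  \sum_(i < n) (z.1 0 i - (i == i0)%:R * g z.2) ^+ 2.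
Definition paraboloid {R : realType} {n : nat} (A k g : R -> R) (i0 : 'I_n)
    (z : spacetime R n) : R :=
  A z.2 - k z.2 * sqdist g i0 z.

Lemma sqdist_ge0 {R : realType} {n : nat} (g : R -> R) (i0 : 'I_n)
    (z : spacetime R n) : 0 <= sqdist g i0 z.
Proof. by rewrite sumr_ge0 // => i _; exact: sqr_ge0. Qed.

Lemma ler_axis_sqdist {R : realType} {n : nat} (g : R -> R) (i0 : 'I_n)
    (z : spacetime R n) : z.1 0 i0 - g z.2 <= Num.sqrt (sqdist g i0 z).
Proof.
rewrite (le_trans (ler_norm _)) // -sqrtr_sqr ler_sqrt ?sqdist_ge0 //.
rewrite /sqdist (bigD1 i0) //= eqxx mul1r lerDl sumr_ge0 // => i _.
exact: sqr_ge0.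
Qed.

Lemma is_derive_sqdist {R : realType} {n : nat} (g : R -> R) (i0 : 'I_n)
    (dg : R) (z v : spacetime R n) :
  is_derive z v (fun z : spacetime R n => g z.2) dg ->
  is_derive z v (sqdist g i0)
    (\sum_(i < n) 2 * (z.1 0 i - (i == i0)%:R * g z.2) *
       (v.1 0 i - (i == i0)%:R * dg)).
Proof.
move=> Dg.
pose f i (z : spacetime R n) := z.1 0 i - (i == i0)%:R * g z.2.
have Df i : is_derive z v (f i) (v.1 0 i - (i == i0)%:R * dg).
  exact: is_deriveB (is_derive_coord i z v) (is_deriveZ (i == i0)%:R Dg).
have -> : sqdist g i0 = \sum_(i < n) (f i) ^+ 2.
  by apply/funext => y; rewrite fct_sumE.
have D i : is_derive z v (f i ^+ 2) (2 * f i z * (v.1 0 i - (i == i0)%:R * dg)).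
  exact: is_deriveX.
exact: is_derive_sum.
Qed.

Lemma is_derive_paraboloid {R : realType} {n : nat} (A k g : R -> R)
    (i0 : 'I_n) (dA dk dg : R) (z v : spacetime R n) :
  is_derive z v (fun z : spacetime R n => A z.2) dA ->
  is_derive z v (fun z : spacetime R n => k z.2) dk ->
  is_derive z v (fun z : spacetime R n => g z.2) dg ->
  is_derive z v (paraboloid A k g i0)
    (dA - (k z.2 * (\sum_(i < n) 2 * (z.1 0 i - (i == i0)%:R * g z.2) *
       (v.1 0 i - (i == i0)%:R * dg)) + sqdist g i0 z * dk)).
Proof.
move=> DA Dk Dg.
exact: is_deriveB DA (is_deriveM Dk (is_derive_sqdist _ i0 _ _ _ Dg)).
Qed.

Lemma derive_x_paraboloid {R : realType} {n : nat} (A k g : R -> R)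
    (i0 j : 'I_n) (z : spacetime R n) :
  'D_(e_x R j) (paraboloid A k g i0) z =
  - 2 * k z.2 * (z.1 0 j - (j == i0)%:R * g z.2).
Proof.
have [_ ->] := is_derive_paraboloid A k g i0 _ _ _ z (e_x R j)
  (is_derive_time0 A z j) (is_derive_time0 k z j) (is_derive_time0 g z j).
rewrite mulr0 addr0 sub0r (bigD1 j) //= big1 => [|i ij].
  by rewrite mxE !eqxx mulr0 subr0 addr0 /=; ring.
by rewrite mxE eqxx (negbTE ij) !mulr0 subr0 mulr0.
Qed.

Lemma hess_paraboloid {R : realType} {n : nat} (A k g : R -> R)
    (i0 : 'I_n) (z : spacetime R n) :
  hess (paraboloid A k g i0) z = - (2 * k z.2)%:M.
Proof.
apply/matrixP => i j; rewrite !mxE.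
have -> : 'D_(e_x R j) (paraboloid A k g i0) = (fun z : spacetime R n =>
    (- 2 * k z.2) * (z.1 0 j - (j == i0)%:R * g z.2)).
  by apply/funext => y; exact: derive_x_paraboloid.
have D1 := is_deriveZ (-2) (is_derive_time0 k z i).
have D2 := is_deriveZ ((j == i0)%:R : R) (is_derive_time0 g z i).
have D3 := is_deriveM D1 (is_deriveB (is_derive_coord j z (e_x R i)) D2).
case: D3 => _ D3; rewrite [LHS]D3 /= !mxE eqxx /= -![_ *: _]/(_ * _).
rewrite !fctE /= -![_ *: _]/(_ * _) eq_sym.
by case: (i == j); rewrite ?mulr0n ?mulr1n /=; ring.
Qed.

Lemma enorm_grad_paraboloid {R : realType} {n : nat} (A k g : R -> R)
    (i0 : 'I_n) (z : spacetime R n) : 0 <= k z.2 ->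
  enorm (grad (paraboloid A k g i0) z) =
  2 * k z.2 * Num.sqrt (sqdist g i0 z).
Proof.
move=> k0; rewrite /enorm.
under eq_bigr => i _ do rewrite mxE derive_x_paraboloid exprMn.
rewrite -mulr_sumr sqrtrM ?sqr_ge0 // sqrtr_sqr mulNr normrN ger0_norm //.
by rewrite mulr_ge0.
Qed.

(** The motion of the vertex contributes at most its speed times the slope,
    hence everything on the right is a function of time and of the distance to
    the vertex. *)
Lemma pde_op_paraboloid_le {R : realType} {n : nat} (lambda Lambda p : R)
    (A k g : R -> R) (A' k' g' : R) (i0 : 'I_n) (z : spacetime R n) :
  lambda <= Lambda -> 0 <= k z.2 -> 0 <= g' ->
  is_derive (z.2 : R) 1 A A' -> is_derive (z.2 : R) 1 k k' ->
  is_derive (z.2 : R) 1 g g' ->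
  pde_op lambda Lambda p (paraboloid A k g i0) z <=
  A' - k' * sqdist g i0 z + 2 * k z.2 * Num.sqrt (sqdist g i0 z) * g'
  + 2 * k z.2 * n%:R * Lambda
  - (2 * k z.2 * Num.sqrt (sqdist g i0 z)) `^ p.
Proof.
move=> lL k0 g0 DA Dk Dg.
rewrite /pde_op enorm_grad_paraboloid // hess_paraboloid lerD2r.
have k20 : 0 <= 2 * k z.2 by rewrite mulr_ge0.
apply: lerD; last by rewrite lerNl pucci_min_scalar_ge.
rewrite /dt; have [_ ->] := is_derive_paraboloid A k g i0 _ _ _ z (e_t R n)
  (is_derive_time _ _ _ _ DA) (is_derive_time _ _ _ _ Dk)
  (is_derive_time _ _ _ _ Dg).
rewrite (bigD1 i0) //= big1 => [|i /negbTE ii0]; last first.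
  by rewrite mxE ii0 !mul0r !subr0 mulr0.
rewrite !mxE eqxx !mul1r addr0 sub0r.
set y := z.1 0 i0 - g z.2; set s := Num.sqrt _.
have ys : y <= s by exact: ler_axis_sqdist.
have : 2 * k z.2 * g' * y <= 2 * k z.2 * g' * s by rewrite ler_wpM2l // mulr_ge0.
lra.
Qed.

Lemma Ck_on_paraboloid {R : realType} {n : nat} (U : set (spacetime R n)) (m : nat)
    (A k g : R -> R) (i0 : 'I_n) : open U ->
  Ck_on U m (fun z : spacetime R n => A z.2) ->
  Ck_on U m (fun z : spacetime R n => k z.2) ->
  Ck_on U m (fun z : spacetime R n => g z.2) ->
  Ck_on U m (paraboloid A k g i0).
Proof.
move=> oU CA Ck Cg.
apply: (Ck_on_eq _ _ (fun z : spacetime R n => A z.2 + (-1 * k z.2) *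
    \sum_(i < n) (z.1 0 i + (- (i == i0)%:R) * g z.2) ^+ 2)) => //.
  move=> z _; rewrite /paraboloid /sqdist mulN1r mulNr; congr (_ - _ * _).
  by apply: eq_bigr => i _; rewrite mulNr.
have cst c : Ck_on U m (fun=> c) by exact: Ck_on_cst.
apply: Ck_onD => //; apply: Ck_onM => //; first exact: Ck_onM.
apply: Ck_on_sum => // i; apply: Ck_on_exp => //; apply: Ck_onD => //.
  exact: Ck_on_coord.
exact: Ck_onM.
Qed.

(** * Absorption by the gradient term *)

(** Young's inequality for the transport term, written so that its remainder
    has the same singularity [theta ^ (- a)] as the opening. The relation
    between [a], [b] and [p] makes both sides homogeneous once [y] is measured
    in units of [theta ^ (- a / p)]. *)
Lemma transport_absorb {R : realType} (p a b beta theta y : R) :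
  2 < p -> 1 - b + a / p = a -> 0 <= beta -> 0 < theta -> 0 <= y ->
  y * (beta * theta `^ (b - 1)) <=
  y `^ p / 2 + (beta ^+ 2 + beta) * theta `^ (- a).
Proof.
move=> p2 bap beta0 th0 y0.
have p0 : p != 0 by rewrite gt_eqF // (lt_trans _ p2).
pose Y := y * theta `^ (a / p).
have Y0 : 0 <= Y by rewrite mulr_ge0 ?powR_ge0.
have cancel r : theta `^ r * theta `^ (- r) = 1.
  by rewrite -powRD ?subrr ?powRr0 // (gt_eqF th0) implybT.
have yE : y = Y * theta `^ (- (a / p)) by rewrite /Y -mulrA cancel mulr1.
have -> : y * (beta * theta `^ (b - 1)) = beta * Y * theta `^ (- a).
  rewrite yE mulrCA !mulrA -mulrA; congr (_ * _).
  rewrite -powRD; last by rewrite (gt_eqF th0) implybT.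
  by congr (_ `^ _); rewrite -[in RHS]bap; ring.
have -> : y `^ p = Y `^ p * theta `^ (- a).
  rewrite {1}yE powRM ?powR_ge0 // -powRrM; congr (_ * _ `^ _).
  by rewrite mulNr divfK.
have : 0 <= theta `^ (- a) by exact: powR_ge0.
have YP : beta * Y <= Y `^ p / 2 + (beta ^+ 2 + beta).
  have [Y1|/ltW Y1] := leP Y 1.
    have := powR_ge0 Y p; have : beta * Y <= beta * 1 by rewrite ler_wpM2l.
    by have := sqr_ge0 beta; lra.
  have : Y `^ 2%:R <= Y `^ p by rewrite ler_powR // ltW.
  rewrite powR_mulrn // => Y2.
  have : 0 <= (Y - beta) ^+ 2 by exact: sqr_ge0.
  have := sqr_ge0 beta.
  rewrite sqrrB; lra.
move=> H; have := ler_wpM2r H YP; lra.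
Qed.

(** The cost of widening the paraboloid. At distances up to the diffusive
    scale, [D <= tau / a], it is comparable with the opening itself; farther out
    the superquadratic gradient term wins, which needs [a >= p / (2 (p - 1))]. *)
Lemma opening_absorb {R : realType} (p a kappa k tau D : R) :
  2 < p -> 0 < a < 1 -> p / 2 <= a * (p - 1) -> 1 <= kappa -> 0 < tau <= 1 ->
  kappa * tau `^ (- a) <= k -> 0 <= D ->
  kappa * (a * tau `^ (- a - 1)) * D <= k + (2 * k * Num.sqrt D) `^ p / 2.
Proof.
move=> p2 /andP[a0 a1] ap kap1 /andP[tau0 tau1] kk D0.
have p0 : 0 < p by rewrite (lt_trans _ p2).
have kap0 : 0 < kappa by rewrite (lt_le_trans _ kap1).
have q0 : 0 < tau `^ (- a) by rewrite powR_gt0.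
have k0 : 0 <= k by rewrite (le_trans _ kk) // mulr_ge0 // ltW.
have -> : tau `^ (- a - 1) = tau `^ (- a) / tau.
  rewrite powRD ?powR_inv1 ?(ltW tau0) // ?(gt_eqF tau0) ?implybT //.
have P0 := powR_ge0 (2 * k * Num.sqrt D) p.
have [aD|aD] := leP (a * D) tau.
  suff : kappa * (a * (tau `^ (- a) / tau)) * D <= kappa * tau `^ (- a) by lra.
  have -> : kappa * (a * (tau `^ (- a) / tau)) * D =
    kappa * tau `^ (- a) * (a * D / tau) by ring.
  by rewrite ler_piMr ?ler_pdivrMr ?mul1r // mulr_ge0 // ltW.
have [E DE] : exists E, D = tau * E.
  by exists (D / tau); rewrite mulrC divfK // gt_eqF.
have E1 : 1 <= E.
  by rewrite -(ler_pM2l tau0) mulr1 -DE (le_trans (ltW aD)) // ler_piMl // ltW.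
have E0 : 0 <= E by rewrite (le_trans _ E1).
have Ep : E <= Num.sqrt E `^ p.
  have s1 : 1 <= Num.sqrt E by rewrite -[1]sqrtr1 ler_wsqrtr.
  have : Num.sqrt E `^ 2%:R <= Num.sqrt E `^ p by rewrite ler_powR // ltW.
  by rewrite powR_mulrn ?sqrtr_ge0 // sqr_sqrtr.
have kp : kappa <= kappa `^ p.
  by rewrite -{1}[kappa]powRr1 ?ler_powR // ltW // (lt_trans _ p2) // ltr1n.
have twop : 4 <= 2 `^ p :> R.
  have : 2 `^ 2%:R <= 2 `^ p :> R by rewrite ler_powR ?ler1n // ltW.
  by rewrite powR_mulrn // -natrX.
have taup : tau `^ (- a) <= (tau `^ (- a) * Num.sqrt tau) `^ p.
  rewrite -powR12_sqrt ?(ltW tau0) // -powRD ?(gt_eqF tau0) ?implybT // -powRrM.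
  rewrite ger_powR ?tau0 //.
  have -> : (- a + 2^-1) * p = p / 2 - a * p by ring.
  by lra.
have : (2 * (kappa * ((tau `^ (- a) * Num.sqrt tau) * Num.sqrt E))) `^ p <=
    (2 * k * Num.sqrt D) `^ p.
  rewrite ge0_ler_powR ?nnegrE ?(ltW p0) ?mulr_ge0 ?sqrtr_ge0 ?powR_ge0 ?(ltW kap0) //.
  rewrite -[leRHS]mulrA ler_pM2l // DE sqrtrM ?(ltW tau0) // !mulrA.
  by do 2![apply: ler_wpM2r; first exact: sqrtr_ge0].
rewrite !powRM ?mulr_ge0 ?sqrtr_ge0 ?powR_ge0 ?(ltW kap0) //.
rewrite -powRM ?sqrtr_ge0 ?powR_ge0 //.
move=> H.
have H2 : 4 * (kappa * (tau `^ (- a) * E)) <=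
    2 `^ p * (kappa `^ p * ((tau `^ (- a) * Num.sqrt tau) `^ p * Num.sqrt E `^ p)).
  apply: ler_pM => //; first by rewrite !mulr_ge0 // ltW.
  apply: ler_pM => //; [exact: ltW|by rewrite mulr_ge0 // ltW|].
  by apply: ler_pM => //; exact: ltW.
have H3 : kappa * (a * (tau `^ (- a) / tau)) * D <= kappa * (tau `^ (- a) * E).
  have -> : kappa * (a * (tau `^ (- a) / tau)) * D =
      a * (kappa * (tau `^ (- a) * E)).
    by rewrite DE; field; rewrite gt_eqF.
  by rewrite ler_piMl ?(ltW a1) // !mulr_ge0 // ltW.
have H4 : 0 <= kappa * (tau `^ (- a) * E) by rewrite !mulr_ge0 // ltW.
lra.
Qed.

Lemma is_derive_powR_shift {R : realType} (eta r t : R) : 0 < eta + t ->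
  is_derive t 1 (fun t => (eta + t) `^ r) (r * (eta + t) `^ (r - 1)).
Proof.
move=> pos.
have := is_deriveD (is_derive_cst eta t 1) (is_derive_id t 1).
rewrite add0r => D.
have := is_derive1_comp (f := fun s => s `^ r) (g := fun t => eta + t)
  (is_derive1_powR r pos) D.
by rewrite mulr1.
Qed.

Lemma is_derive_powR_flip {R : realType} (T r t : R) : 0 < T - t ->
  is_derive t 1 (fun t => (T - t) `^ r) (- (r * (T - t) `^ (r - 1))).
Proof.
move=> pos.
have := is_deriveB (is_derive_cst T t 1) (is_derive_id t 1).
rewrite sub0r => D.
have := is_derive1_comp (f := fun s => s `^ r) (g := fun t => T - t)
  (is_derive1_powR r pos) D.
by rewrite mulrN1.
Qed.

(** * The barrier *)

(** [eta] regularizes the initial singularity of the opening; the final one,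
    at time [T], is kept. *)
Definition opening {R : realType} (a kappa eta T t : R) : R :=
  kappa * ((eta + t) `^ (- a) + (T - t) `^ (- a)).
(** The distance to the boundary decreases from [d] at time [0] to [0] at time
    [T], like the power [b = a / 2] that matches the width of the paraboloid. *)
Definition vertex {R : realType} (b d T t : R) : R :=
  1 - d * T `^ (- b) * (T - t) `^ b.
(** A primitive of [- N ((eta + t) ^ (- a) + (T - t) ^ (- a))]. *)
Definition height {R : realType} (a A0 N eta T t : R) : R :=
  A0 - N / (1 - a) * ((eta + t) `^ (1 - a) + (T `^ (1 - a) - (T - t) `^ (1 - a))).
Definition barrier {R : realType} {n : nat} (a b d kappa A0 N eta T : R)
    (i0 : 'I_n) : spacetime R n -> R :=
  paraboloid (height a A0 N eta T) (opening a kappa eta T) (vertex b d T) i0.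

Lemma is_derive_opening {R : realType} (a kappa eta T t : R) :
  0 < eta + t -> 0 < T - t ->
  is_derive t 1 (opening a kappa eta T)
    (kappa * (a * (T - t) `^ (- a - 1) - a * (eta + t) `^ (- a - 1))).
Proof.
move=> tau0 th0.
have := is_deriveZ kappa (is_deriveD (is_derive_powR_shift eta (- a) t tau0)
  (is_derive_powR_flip T (- a) t th0)).
by move=> D; apply: (is_derive_eq D); rewrite -[_ *: _]/(_ * _); ring.
Qed.

Lemma is_derive_vertex {R : realType} (b d T t : R) : 0 < T - t ->
  is_derive t 1 (vertex b d T) (d * T `^ (- b) * (b * (T - t) `^ (b - 1))).
Proof.
move=> th0.
have := is_deriveB (is_derive_cst (1 : R) t 1)
  (is_deriveZ (d * T `^ (- b)) (is_derive_powR_flip T b t th0)).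
by move=> D; apply: (is_derive_eq D); rewrite -[_ *: _]/(_ * _); ring.
Qed.

Lemma is_derive_height {R : realType} (a A0 N eta T t : R) :
  a < 1 -> 0 < eta + t -> 0 < T - t ->
  is_derive t 1 (height a A0 N eta T)
    (- (N * ((eta + t) `^ (- a) + (T - t) `^ (- a)))).
Proof.
move=> a1 tau0 th0.
have := is_deriveB (is_derive_cst A0 t 1) (is_deriveZ (N / (1 - a))
  (is_deriveD (is_derive_powR_shift eta (1 - a) t tau0)
     (is_deriveB (is_derive_cst (T `^ (1 - a)) t 1)
       (is_derive_powR_flip T (1 - a) t th0)))).
move=> D; apply: (is_derive_eq D); rewrite -[_ *: _]/(_ * _).
have -> : 1 - a - 1 = - a by ring.
by field; rewrite subr_eq0 gt_eqF.
Qed.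

(** The constant [N] pays for diffusion, [2 n Lambda kappa], for widening,
    [kappa], and for the motion of the vertex, the rest. *)
Lemma pde_op_barrier_lt0 {R : realType} {n : nat}
    (lambda Lambda p a b d kappa A0 N eta T : R) (i0 : 'I_n)
    (z : spacetime R n) :
  0 < lambda < Lambda -> 2 < p -> 0 < a < 1 -> p / 2 <= a * (p - 1) ->
  1 - b + a / p = a -> 0 < b <= 1 -> 0 < d <= 1 -> 1 <= kappa ->
  eta + T <= 1 -> 0 < eta + z.2 -> z.2 < T ->
  (2 * n%:R * Lambda + 1) * kappa +
    ((T `^ (- b)) ^+ 2 + T `^ (- b)) < N ->
  pde_op lambda Lambda p (barrier a b d kappa A0 N eta T i0) z < 0.
Proof.
move=> /andP[l0 lL] p2 a01 ap bap /andP[b0 b1] /andP[d0 d1] kap1 etaT.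
move=> tau0 tT NN; have [a0 a1] := andP a01.
have th0 : 0 < T - z.2 by rewrite subr_gt0.
have kap0 : 0 < kappa by rewrite (lt_le_trans _ kap1).
set S1 := (eta + z.2) `^ (- a); set S2 := (T - z.2) `^ (- a).
have S10 : 0 < S1 by rewrite powR_gt0.
have S20 : 0 < S2 by rewrite powR_gt0.
pose k := opening a kappa eta T z.2.
have kE : k = kappa * (S1 + S2) by [].
have k0 : 0 <= k by rewrite kE mulr_ge0 // ?addr_ge0 // ltW.
pose beta := T `^ (- b).
have beta0 : 0 <= beta by exact: powR_ge0.
pose g' := d * beta * (b * (T - z.2) `^ (b - 1)).
have g'0 : 0 <= g' by rewrite !mulr_ge0 ?powR_ge0 // ltW.
have := pde_op_paraboloid_le lambda Lambda p _ _ _ _ _ g' i0 z (ltW lL) k0 g'0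
  (is_derive_height a A0 N eta T z.2 a1 tau0 th0)
  (is_derive_opening a kappa eta T z.2 tau0 th0)
  (is_derive_vertex b d T z.2 th0).
move=> H; apply: le_lt_trans H _.
rewrite -/k -/S1 -/S2; set D := sqdist _ _ _; set y := 2 * k * Num.sqrt D.
have D0 : 0 <= D by exact: sqdist_ge0.
have y0 : 0 <= y.
  by apply: mulr_ge0; [apply: mulr_ge0 k0|exact: sqrtr_ge0].
have H1 : kappa * (a * (eta + z.2) `^ (- a - 1)) * D <= k + y `^ p / 2.
  apply: opening_absorb => //.
    by rewrite tau0 (le_trans _ etaT) // lerD2l ltW.
  by rewrite kE ler_wpM2l ?(ltW kap0) // lerDl ltW.
have H2 := transport_absorb p a b beta (T - z.2) y p2 bap beta0 th0 y0.
have H3 : y * g' <= y * (beta * (T - z.2) `^ (b - 1)).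
  rewrite ler_wpM2l // /g' mulrA ler_wpM2r ?powR_ge0 //.
  by rewrite mulrAC ler_piMl // mulr_ile1 // ltW.
have H4 : 0 <= kappa * (a * (T - z.2) `^ (- a - 1)) * D.
  by rewrite !mulr_ge0 ?powR_ge0 // ltW.
have H5 : ((2 * n%:R * Lambda + 1) * kappa + (beta ^+ 2 + beta)) * (S1 + S2) <
    N * (S1 + S2) by rewrite ltr_pM2r // addr_gt0.
have H6 : 0 <= (beta ^+ 2 + beta) * S1.
  by rewrite mulr_ge0 ?addr_ge0 ?sqr_ge0 // ltW.
rewrite -/S2 in H2; rewrite kE in H1 *.
move: H1 H2 H3 H4 H5 H6. rewrite /g'; lra.
Qed.

Definition slab {R : realType} {n : nat} (eta T : R) : set (spacetime R n) :=
  [set z | 0 < eta + z.2 /\ z.2 < T].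

Lemma open_slab {R : realType} {n : nat} (eta T : R) :
  open (@slab R n eta T).
Proof.
have c2 (z : spacetime R n) : {for z, continuous (fun z : spacetime R n => z.2 : R)}.
  exact: cvg_snd.
rewrite openE => z [z1 z2]; apply: filterI; last exact: (cvgr_lt _ (c2 z)).
have : \forall y \near z, - eta < y.2.
  by apply: (cvgr_gt _ (c2 z)); rewrite -subr_gt0 opprK addrC.
by apply: filterS => y; rewrite -subr_gt0 opprK addrC.
Qed.

Lemma Ck_on_barrier {R : realType} {n : nat} (a b d kappa A0 N eta T : R)
    (i0 : 'I_n) (m : nat) :
  Ck_on (@slab R n eta T) m (barrier a b d kappa A0 N eta T i0).
Proof.
have oU := @open_slab R n eta T.
have C1 r : Ck_on (@slab R n eta T) m
    (fun z : spacetime R n => (eta + z.2) `^ r).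
  apply: (Ck_on_eq _ _ (fun z : spacetime R n => (eta + 1 * z.2) `^ r)) => //.
    by move=> z _; rewrite mul1r.
  by apply: Ck_on_powR_time => // z [z1 _]; rewrite mul1r.
have C2 r : Ck_on (@slab R n eta T) m
    (fun z : spacetime R n => (T - z.2) `^ r).
  apply: (Ck_on_eq _ _ (fun z : spacetime R n => (T + -1 * z.2) `^ r)) => //.
    by move=> z _; rewrite mulN1r.
  by apply: Ck_on_powR_time => // z [_ z2]; rewrite mulN1r subr_gt0.
have C0 c : Ck_on (@slab R n eta T) m (fun=> c) by exact: Ck_on_cst.
apply: Ck_on_paraboloid => //.
- apply: (Ck_on_eq _ _ (fun z : spacetime R n => A0 + - (N / (1 - a)) *
    ((eta + z.2) `^ (1 - a) + (T `^ (1 - a) + (-1) * (T - z.2) `^ (1 - a))))) => //.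
    by move=> z _; rewrite /height mulN1r mulNr.
  apply: Ck_onD => //; apply: Ck_onM => //; apply: Ck_onD => //.
  by apply: Ck_onD => //; exact: Ck_onM.
- by apply: Ck_onM => //; exact: Ck_onD.
- apply: (Ck_on_eq _ _ (fun z : spacetime R n =>
    1 + - (d * T `^ (- b)) * (T - z.2) `^ b)) => //.
    by move=> z _; rewrite /vertex mulNr.
  by apply: Ck_onD => //; exact: Ck_onM.
Qed.

(** The triangle inequality through the vertex. *)
Lemma enorm_le_sqdist {R : realType} {n : nat} (g : R -> R) (i0 : 'I_n)
    (z : spacetime R n) :
  0 <= g z.2 -> enorm z.1 <= Num.sqrt (sqdist g i0 z) + g z.2.
Proof.
move=> g0; set s := Num.sqrt _; set c := g z.2.
have s0 : 0 <= s by exact: sqrtr_ge0.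
rewrite -(@ger0_norm _ (s + c)) ?addr_ge0 // -sqrtr_sqr ler_sqrt ?sqr_ge0 //.
have ss : s ^+ 2 = sqdist g i0 z by rewrite sqr_sqrtr // sqdist_ge0.
have ys : z.1 0 i0 - c <= s by exact: ler_axis_sqdist.
have -> : \sum_(i < n) z.1 0 i ^+ 2 =
    sqdist g i0 z + 2 * c * (z.1 0 i0 - c) + c ^+ 2.
  rewrite /sqdist (bigD1 i0) //= [in RHS](bigD1 i0) //= eqxx mul1r -/c.
  rewrite (eq_bigr (fun i => (z.1 0 i - (i == i0)%:R * c) ^+ 2)).
    by move=> *; ring.
  by move=> i /negbTE ->; rewrite mul0r subr0.
have : 2 * c * (z.1 0 i0 - c) <= 2 * c * s by rewrite ler_wpM2l // mulr_ge0.
by rewrite -ss sqrrD; lra.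
Qed.

(** * The barrier lies below the solution *)

Lemma powR_cancel {R : realType} (x r : R) : 0 < x -> x `^ r * x `^ (- r) = 1.
Proof.
by move=> x0; rewrite -powRD ?subrr ?powRr0 // (gt_eqF x0) implybT.
Qed.

Lemma vertex_01 {R : realType} (b d T t : R) :
  0 <= b -> 0 <= d <= 1 -> 0 < T -> 0 <= t <= T -> 0 <= vertex b d T t <= 1.
Proof.
move=> b0 /andP[d0 d1] T0 /andP[t0 tT].
rewrite /vertex lerBlDr lerDl !mulr_ge0 ?powR_ge0 // andbT.
rewrite subr_ge0 -(powR_cancel T b T0) (mulrC (T `^ b)).
apply: (@le_trans _ _ (T `^ (- b) * (T - t) `^ b)).
  by rewrite ler_wpM2r ?powR_ge0 // ler_piMl ?powR_ge0.
rewrite ler_wpM2l ?powR_ge0 //; apply: ge0_ler_powR; rewrite ?nnegrE //.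
- by rewrite subr_ge0.
- exact: ltW.
- by rewrite lerBlDr lerDl.
Qed.

Lemma enorm_axis {R : realType} {n : nat} (i0 : 'I_n) (r : R) :
  enorm (r *: delta_mx 0 i0 : 'rV[R]_n) = `|r|.
Proof.
rewrite /enorm (bigD1 i0) //= big1 => [|i ii0].
  by rewrite !mxE !eqxx mulr1 addr0 sqrtr_sqr.
by rewrite !mxE (negbTE ii0) mulr0 expr0n.
Qed.

Lemma height_le {R : realType} (a A0 N eta T t : R) :
  a < 1 -> 0 <= N -> 0 <= t < T -> height a A0 N eta T t <= A0.
Proof.
move=> a1 N0 /andP[t0 tT]; rewrite /height lerBlDr lerDl.
have a10 : 0 <= 1 - a by rewrite subr_ge0 ltW.
rewrite mulr_ge0 ?divr_ge0 // addr_ge0 ?powR_ge0 // subr_ge0.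
have T0 : 0 <= T by rewrite (le_trans t0) // ltW.
by apply: ge0_ler_powR => //; rewrite ?nnegrE ?subr_ge0 ?(ltW tT) // lerBlDr lerDl.
Qed.

(** With [rho = eta + t] this bounds the support of the barrier near the initial
    time, with [rho = T - t] near the final one. *)
Lemma barrier_gt0_sqdist {R : realType} {n : nat}
    (a b d kappa A0 N eta T rho : R) (i0 : 'I_n) (z : spacetime R n) :
  0 < a < 1 -> b + b = a -> 0 < d -> 1 <= kappa -> 0 <= N ->
  A0 * T `^ a <= kappa * d ^+ 2 -> 0 <= z.2 < T -> 0 < rho ->
  kappa * rho `^ (- a) <= opening a kappa eta T z.2 ->
  0 < barrier a b d kappa A0 N eta T i0 z ->
  Num.sqrt (sqdist (vertex b d T) i0 z) < d * T `^ (- b) * rho `^ b.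
Proof.
move=> /andP[a0 a1] bb d0 kap1 N0 kapd tT rho0 kr.
rewrite /barrier /paraboloid subr_gt0; set D := sqdist _ _ _ => pos.
have T0 : 0 < T by case/andP: tT; exact: le_lt_trans.
have kap0 : 0 < kappa by rewrite (lt_le_trans _ kap1).
have D0 : 0 <= D by exact: sqdist_ge0.
have sq (x : R) : 0 < x -> forall r, x `^ r ^+ 2 = x `^ (r + r).
  by move=> x0 r; rewrite expr2 -powRD // (gt_eqF x0) implybT.
set L := d * _ * _.
have L0 : 0 < L by rewrite !mulr_gt0 ?powR_gt0.
rewrite -(gtr0_norm L0) -sqrtr_sqr ltr_sqrt ?exprn_gt0 //.
have -> : L ^+ 2 = d ^+ 2 * T `^ (- a) * rho `^ a.
  by rewrite !exprMn !sq // -opprD bb.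
have H : kappa * rho `^ (- a) * D < A0.
  apply: le_lt_trans (lt_le_trans pos (height_le _ _ _ _ _ _ a1 N0 tT)).
  by rewrite ler_wpM2r.
have c1 := powR_cancel rho a rho0; have c2 := powR_cancel T a T0.
rewrite -(ltr_pM2l (mulr_gt0 kap0 (powR_gt0 (- a) rho0))).
apply: (lt_le_trans H).
have -> : kappa * rho `^ (- a) * (d ^+ 2 * T `^ (- a) * rho `^ a) =
  (kappa * d ^+ 2) * T `^ (- a) * (rho `^ a * rho `^ (- a)) by ring.
rewrite c1 mulr1 -[leLHS]mulr1 -c2 mulrA ler_wpM2r ?powR_ge0 //.
Qed.

(** The positivity set is a ball around the vertex whose radius is less than the
    distance of the vertex to the boundary. *)
Lemma barrier_gt0_uball {R : realType} {n : nat}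
    (a b d kappa A0 N eta T : R) (i0 : 'I_n) (z : spacetime R n) :
  0 < a < 1 -> b + b = a -> 0 < d <= 1 -> 1 <= kappa -> 0 <= N ->
  A0 * T `^ a <= kappa * d ^+ 2 -> 0 <= z.2 < T ->
  0 < barrier a b d kappa A0 N eta T i0 z -> uball z.1.
Proof.
move=> a01 bb /andP[d0 d1] kap1 N0 kapd tT pos.
have [t0 tT'] := andP tT; have T0 := le_lt_trans t0 tT'.
have th0 : 0 < T - z.2 by rewrite subr_gt0.
have H : Num.sqrt (sqdist (vertex b d T) i0 z) <
    d * T `^ (- b) * (T - z.2) `^ b.
  apply: (barrier_gt0_sqdist a b d kappa A0 N eta T _ i0 z a01) => //.
  by rewrite ler_wpM2l ?(le_trans _ kap1) // lerDr powR_ge0.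
rewrite /uball /=.
have b0 : 0 <= b by case/andP: a01 => a0 _; lra.
have [g0 _] : 0 <= vertex b d T z.2 /\ vertex b d T z.2 <= 1.
  by apply/andP; apply: vertex_01; rewrite ?t0 ?(ltW d0) ?(ltW tT').
apply: le_lt_trans (enorm_le_sqdist (vertex b d T) i0 z g0) _.
by rewrite /vertex; lra.
Qed.

(** The datum need only exceed [A0] where the barrier is positive at time [0];
    elsewhere on the parabolic boundary [u >= 0] suffices. *)
Lemma barrier_le_solution {R : realType} {n : nat}
    (lambda Lambda p a b d kappa A0 N eta T : R) (i0 : 'I_n)
    (u0 : 'rV[R]_n -> R) (u : spacetime R n -> R) :
  0 < lambda < Lambda -> 2 < p -> 0 < a < 1 -> p / 2 <= a * (p - 1) ->
  1 - b + a / p = a -> b + b = a -> 0 < d <= 1 -> 1 <= kappa ->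
  0 < eta -> 0 < T -> eta + T <= 1 ->
  (2 * n%:R * Lambda + 1) * kappa +
    ((T `^ (- b)) ^+ 2 + T `^ (- b)) < N ->
  A0 * T `^ a <= kappa * d ^+ 2 ->
  (forall x, cl_uball x -> 0 <= u0 x) ->
  (forall x, cl_uball x ->
     Num.sqrt (sqdist (vertex b d T) i0 (x, 0)) < d * T `^ (- b) * eta `^ b ->
     A0 <= u0 x) ->
  viscosity_solution lambda Lambda p u0 u ->
  (forall (x : 'rV[R]_n) (t : R), usphere x -> 0 < t -> u (x, t) = 0) ->
  forall t : R, 0 <= t < T ->
    cl_uball (vertex b d T t *: delta_mx 0 i0 : 'rV[R]_n) /\
    height a A0 N eta T t <= u (vertex b d T t *: delta_mx 0 i0, t).
Proof.
move=> lL p2 a01 ap bap bb d01 kap1 eta0 T0 etaT NN kapd u0_ge0 u0_big.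
move=> [cu eqn init _] lat t /andP[t0 tT].
have [d0 d1] := andP d01; have [a0 a1] := andP a01.
have b1 : 0 < b <= 1 by lra.
have kap0 : 0 <= kappa by rewrite (le_trans _ kap1).
have L0 : 0 <= Lambda by case/andP: lL => l0 /ltW; apply: le_trans; exact: ltW.
have N0 : 0 <= N.
  apply: le_trans (ltW NN); rewrite addr_ge0 ?addr_ge0 ?sqr_ge0 ?powR_ge0 //.
  by rewrite mulr_ge0 // addr_ge0 // !mulr_ge0.
pose phi := @barrier R n a b d kappa A0 N eta T i0.
(* The barrier is singular at time [T], so the comparison stops before. *)
pose T' := (t + T) / 2.
have [tT' T'T] : t < T' /\ T' < T by rewrite /T'; split; lra.
have T'0 : 0 < T' by exact: le_lt_trans tT'.
have slabz (z : spacetime R n) : 0 <= z.2 <= T' -> slab eta T z.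
  by move=> /andP[z0 zT]; split; [rewrite ltr_wpDr|exact: le_lt_trans T'T].
have le_phi (z : spacetime R n) : cl_uball z.1 -> 0 <= z.2 < T' ->
    phi z <= u z.
  apply: (strict_subsolution_le lambda Lambda p) => //.
  - move=> y _ yT; have [+ _] := @Ck_on_barrier R n a b d kappa A0 N eta T i0 0%N.
    by apply; exact: slabz.
  - move=> x xb; rewrite init //.
    have [phi0|phi0] := leP (phi (x, 0)) 0; first exact: le_trans (u0_ge0 x xb).
    apply: (@le_trans _ _ A0).
      apply: (@le_trans _ _ (height a A0 N eta T 0)).
        rewrite /phi /barrier /paraboloid /= lerBlDr lerDl.
        by rewrite mulr_ge0 ?sqdist_ge0 // mulr_ge0 // addr_ge0 ?powR_ge0.
      by apply: height_le => //; rewrite lexx.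
    apply: u0_big => //.
    apply: (barrier_gt0_sqdist a b d kappa A0 N eta T _ i0 (x, 0) a01) => //.
      by rewrite lexx.
    by rewrite ler_wpM2l // addr0 lerDl powR_ge0.
  - move=> x s xs /andP[s0 sT']; rewrite lat // leNgt; apply/negP => pos.
    have : uball x.
      apply: (barrier_gt0_uball a b d kappa A0 N eta T i0 (x, s)) pos => //.
      by rewrite /= (ltW s0) (le_lt_trans sT').
    by rewrite /uball /= xs ltxx.
  - move=> y [_ y0] yT' _.
    have sy : slab eta T y by apply: slabz; rewrite ltW.
    split.
      exists (slab eta T); split=> //; first exact: open_slab.
      by move=> k; exact: Ck_on_barrier.
    by case: sy => s1 s2; apply: pde_op_barrier_lt0.
have v01 : 0 <= vertex b d T t <= 1.
  by apply: vertex_01; rewrite ?t0 ?(ltW d0) ?(ltW tT) //; case/andP: b1 => /ltW.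
have vb : cl_uball (vertex b d T t *: delta_mx 0 i0 : 'rV[R]_n).
  by rewrite /cl_uball /= enorm_axis; case/andP: v01 => v0 v1; rewrite ger0_norm.
split=> //; apply: le_trans (le_phi (_, t) vb _); last by rewrite /= t0.
rewrite /phi /barrier /paraboloid /sqdist /= big1 ?mulr0 ?subr0 // => i _.
by rewrite !mxE eqxx /= mulrC subrr expr0n.
Qed.

(** * Positivity at the boundary *)

(** The part of the loss that is proportional to [A0] also carries a factor
    [T ^ a T ^ (1 - a) = T]; hence [T] can be chosen before [A0]. *)
Lemma height_ge {R : realType} (a A0 K C eta T t : R) :
  0 < a < 1 -> 0 < K -> 0 <= C -> 0 < T <= 1 ->
  256 * K * T <= 1 - a -> 16 * (C + 1) / (1 - a) <= A0 ->
  0 < eta <= T -> 0 <= t < T ->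
  A0 / 4 <= height a A0 (K * (16 * (A0 * T `^ a)) + C + 1) eta T t.
Proof.
move=> /andP[a0 a1] K0 C0 /andP[T0 T1] KT CA /andP[eta0 etaT] /andP[t0 tT].
have a10 : 0 < 1 - a by rewrite subr_gt0.
have A00 : 0 <= A0.
  by apply: le_trans CA; rewrite divr_ge0 ?(ltW a10) // mulr_ge0 // addr_ge0.
set P := T `^ (1 - a).
have P0 : 0 <= P by exact: powR_ge0.
have P1 : P <= 1.
  have : T `^ (1 - a) <= 1 `^ (1 - a).
    by apply: ge0_ler_powR; rewrite ?nnegrE ?(ltW T0) ?(ltW a10).
  by rewrite powR1.
have PT : T `^ a * P = T.
  rewrite /P -powRD ?(gt_eqF T0) ?implybT // addrC subrK powRr1 //; exact: ltW.
have tau2 : (eta + t) `^ (1 - a) <= 2 * P.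
  apply: (@le_trans _ _ ((2 * T) `^ (1 - a))).
    apply: ge0_ler_powR; rewrite ?nnegrE ?(ltW a10) //; [| |lra].
      by rewrite addr_ge0 // ltW.
    by rewrite mulr_ge0 // ltW.
  rewrite powRM ?(ltW T0) // ler_wpM2r //.
  rewrite -[leRHS]powRr1 // ler_powR ?ler1n //; lra.
have th0 : 0 <= (T - t) `^ (1 - a) by exact: powR_ge0.
rewrite /height -/P; set X := _ + (P - _).
have X3 : X <= 3 * P by rewrite /X; lra.
set N := _ + C + 1.
have N0 : 0 <= N.
  by rewrite /N !addr_ge0 // !mulr_ge0 ?powR_ge0 // ltW.
have NP : N * P <= (16 * K * T) * A0 + (C + 1).
  have -> : N * P = 16 * K * (T `^ a * P) * A0 + (C + 1) * P by rewrite /N; ring.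
  by rewrite PT lerD2l ler_piMr // addr_ge0.
have H : N * X <= 3 / 4 * A0 * (1 - a).
  apply: (@le_trans _ _ (3 * (N * P))).
    by rewrite [leRHS]mulrCA ler_wpM2l.
  have h1 : 16 * (C + 1) <= A0 * (1 - a) by rewrite -ler_pdivrMr.
  have h2 : 256 * K * T * A0 <= (1 - a) * A0 by rewrite ler_wpM2r.
  lra.
have -> : N / (1 - a) * X = N * X / (1 - a) by ring.
rewrite lerBrDr -lerBrDl ler_pdivrMr //; lra.
Qed.

Lemma boundary_value_gt0 {R : realType} {n : nat}
    (u : spacetime R n -> R) (b d T h : R) (i0 : 'I_n) :
  0 < b <= 1 -> 0 < d <= 1 -> 0 < T <= 1 -> 0 < h ->
  {within @cl_cyl0 R n, continuous u} ->
  (forall t : R, 0 <= t < T ->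
    cl_uball (vertex b d T t *: delta_mx 0 i0 : 'rV[R]_n) /\
    h <= u (vertex b d T t *: delta_mx 0 i0, t)) ->
  0 < u (delta_mx 0 i0, T).
Proof.
move=> /andP[b0 b1] /andP[d0 d1] /andP[T0 T1] h0 cu low.
rewrite ltNge; apply/negP => u0.
have eb : cl_cyl0 ((delta_mx 0 i0 : 'rV[R]_n), T).
  split; last exact: ltW.
  have := enorm_axis (n := n) i0 (1 : R); rewrite scale1r normr1 => e1.
  by rewrite /cl_uball /= e1.
move/subspace_continuousP: cu => /(_ _ eb) cu.
have /nbhs_ballP[eps /= eps0 Heps] :
    \forall y \near ((delta_mx 0 i0 : 'rV[R]_n), T), cl_cyl0 y -> u y < h.
  apply: (cvgr_lt _ cu); exact: le_lt_trans h0.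
have [m [m0 me m1]] : exists m : R, [/\ 0 < m, m < eps & m < 1].
  have : 0 < Num.min eps 1 by rewrite lt_min eps0 ltr01.
  have : Num.min eps 1 <= eps by rewrite ge_min lexx.
  have : Num.min eps 1 <= 1 by rewrite ge_min lexx orbT.
  by exists (Num.min eps 1 / 2); split; lra.
(* At time [T - T q] the vertex is at distance [d m] from the boundary. *)
pose q := m `^ b^-1.
have q0 : 0 < q by rewrite powR_gt0.
have qm : q <= m.
  rewrite -[leRHS](powRr1 (ltW m0)); apply: ger_powR.
    by rewrite m0 ltW.
  by rewrite -invr1 lef_pV2 // posrE.
pose t := T - T * q.
have Tq : T * q < eps /\ T * q < T.
  have : T * q <= q by rewrite ler_piMl // ltW.
  have : T * q < T * 1 by rewrite ltr_pM2l //; lra.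
  by split; lra.
have t0T : 0 <= t < T.
  have : 0 < T * q by rewrite mulr_gt0.
  by rewrite /t; lra.
have vE : vertex b d T t = 1 - d * m.
  rewrite /vertex (_ : T - t = T * q); last by rewrite /t; ring.
  rewrite powRM ?(ltW T0) ?(ltW q0) // -powRrM mulVf ?gt_eqF //.
  rewrite powRr1 ?(ltW m0) // mulrA -(mulrA d) (mulrC (T `^ _)).
  by rewrite powR_cancel // mulr1.
have [vb] := low t t0T; rewrite leNgt => /negP; apply.
apply: Heps; last by split=> //=; case/andP: t0T.
split=> /=; last first.
  by rewrite /ball /= /t opprB addrC subrK ger0_norm ?(mulr_ge0 _ (ltW q0)) ?(ltW T0) //; case: Tq.
split=> // i j; rewrite /ball /= !mxE vE.
case: (_ && _) => /=; last by rewrite mulr0 subr0 normr0.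
rewrite mulr1 opprB addrC subrK ger0_norm ?mulr_ge0 ?(ltW d0) ?(ltW m0) //.
by apply: le_lt_trans me; rewrite ler_piMl // ltW.
Qed.

(** * Reduction to a point value *)

Lemma Rintegral_gt_exists {R : realType} (f : R -> R) (c d M : R) :
  c <= d -> d - c <= 1 -> 0 <= M -> {within `[c, d], continuous f} ->
  M < \int[lebesgue_measure]_(r in `[c, d]) f r ->
  exists2 r, c <= r <= d & M < f r.
Proof.
move=> cd dc1 M0 cf; apply: contraPP => /forall2NP H; apply/negP; rewrite -leNgt.
have fM r : r \in `[c, d] -> f r <= M.
  rewrite in_itv /= => cr; rewrite leNgt; apply/negP => Mf.
  by case: (H r).
have int g : {within `[c, d], continuous g} ->
    lebesgue_measure.-integrable `[c, d] (EFin \o g).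
  by apply: continuous_compact_integrable; exact: segment_compact.
apply: (@le_trans _ _ (\int[lebesgue_measure]_(r in `[c, d]) cst M r)).
  apply: le_Rintegral => //; first exact: int.
  by apply: int => r; exact: cvg_cst.
rewrite Rintegral_cst //; have := @lebesgue_measure_itv R `[c, d].
move=> /(congr1 fine) ->; rewrite /= lte_fin.
case: ifP => _ /=; last by rewrite mulr0.
by rewrite -[leRHS]mulr1 ler_wpM2l.
Qed.


Lemma open_uball {R : realType} {n : nat} : open (@uball R n).
Proof.
rewrite (_ : @uball R n = (@enorm R n) @^-1` [set r | r < 1]) //.
by apply: open_comp => [x _|]; [exact: continuous_enorm|exact: open_lt].
Qed.

Lemma continuous_at_uball {R : realType} {n : nat} (f : 'rV[R]_n -> R)
    (x : 'rV[R]_n) :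
  {within @cl_uball R n, continuous f} -> uball x -> {for x, continuous f}.
Proof.
move=> cf xb.
have : {within @uball R n, continuous f}.
  by apply: continuous_subspaceW cf => y; exact: ltW.
rewrite continuous_open_subspace; last exact: open_uball.
by apply; rewrite inE.
Qed.

Theorem theorem1p2 (R : realType) (n : nat) (lambda Lambda : R)
    (n_gt0 : (0 < n)%N) (lambda_gt0 : 0 < lambda) (lt_lL : lambda < Lambda) :
  exists delta : R, 0 < delta < 1 / 2 /\
    forall p : R, 2 < p ->
      exists M : R, 0 < M /\
        forall (u0 : 'rV[R]_n -> R) (v0 : R -> R),
          C1_cl_uball u0 ->
          (forall x, cl_uball x -> u0 x = v0 (enorm x)) ->
          (forall x, cl_uball x -> 0 <= u0 x) ->
          (forall x, usphere x -> u0 x = 0) ->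
          M < \int[lebesgue_measure]_(r in `[delta, 1 - delta]) v0 r ->
          forall u : spacetime R n -> R,
            viscosity_solution lambda Lambda p u0 u ->
            exists T : R, 0 < T /\ LOBC_at u T.
Proof.
exists (1 / 4); split; first by lra.
move=> p p2.
have p3 : 0 < 3 * p - 2 by lra.
(* [a = 2 b] and [b] solve [1 - b + a / p = a], the homogeneity required by
   [transport_absorb]; as [p > 2], this gives [p / (2 (p - 1)) <= a < 1]. *)
pose b := p / (3 * p - 2); pose a := 2 * p / (3 * p - 2).
have bb : b + b = a by rewrite /a /b; field; rewrite gt_eqF.
have a01 : 0 < a < 1.
  by rewrite divr_gt0 ?ltr_pdivrMr ?mul1r //; lra.
have ap : p / 2 <= a * (p - 1).
  have -> : a * (p - 1) = 2 * p * (p - 1) / (3 * p - 2) by rewrite /a; ring.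
  have : 0 <= p * (p - 2) by rewrite mulr_ge0; lra.
  by rewrite ler_pdivlMr //; lra.
have bap : 1 - b + a / p = a.
  rewrite /a /b; field; rewrite !gt_eqF //; lra.
have [a0 a1] := andP a01.
have a10 : 0 < 1 - a by rewrite subr_gt0.
have L0 : 0 < Lambda by rewrite (lt_trans lambda_gt0).
pose K := 2 * n%:R * Lambda + 1.
have K1 : 1 <= K by rewrite lerDr !mulr_ge0 // ltW.
have K0 : 0 < K by rewrite (lt_le_trans _ K1).
have [T [T0 KT]] : exists T, 0 < T /\ 256 * K * T = 1 - a.
  have : 0 < 256 * K by rewrite mulr_gt0.
  move: (256 * K) => c c0; exists ((1 - a) / c); split; first exact: divr_gt0.
  by rewrite mulrC divfK // gt_eqF.
have T12 : T + T <= 1.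
  have : T <= K * T by rewrite ler_peMl // ltW.
  by move: KT; lra.
pose C := (T `^ (- b)) ^+ 2 + T `^ (- b).
have C0 : 0 <= C by rewrite addr_ge0 ?sqr_ge0 ?powR_ge0.
pose A0 := T `^ (- a) + 16 * (C + 1) / (1 - a).
have CA : 16 * (C + 1) / (1 - a) <= A0 by rewrite lerDr powR_ge0.
have A00 : 0 < A0.
  by apply: lt_le_trans CA; rewrite divr_gt0 // mulr_gt0 // ltr_wpDl.
exists A0; split=> // u0 v0 [cu0 _] u0v0 u0_ge0 _ intM u usol.
apply: contrapT => noLOBC.
have lat (x : 'rV[R]_n) (t : R) : usphere x -> 0 < t -> u (x, t) = 0.
  move=> xs t0; apply: contrapT => uxt; apply: noLOBC.
  by exists t; split=> //; exists x.
pose i0 := Ordinal n_gt0.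
have [r0 /andP[r01 r02] big] : exists2 r, 1 / 4 <= r <= 1 - 1 / 4 & A0 < v0 r.
  apply: Rintegral_gt_exists intM; [lra|lra|exact: ltW|].
  apply: continuous_in_subspaceT => r; rewrite inE /= in_itv /= => /andP[r1 r2].
  have rb : uball (r *: delta_mx 0 i0 : 'rV[R]_n).
    rewrite /uball /= enorm_axis ger0_norm; lra.
  have cr := continuous_at_uball u0 _ cu0 rb.
  have cs : {for r, continuous (fun s : R => s *: delta_mx 0 i0 : 'rV[R]_n)}.
    exact: scalel_continuous.
  have := continuous_comp cs cr; apply: continuous_at_near_eq.
  have : \forall s \near r, 0 < s < 1.
    have s01 : 0 < r < 1 by lra.
    exact: (near_in_itvoo s01).
  apply: filterS => s /andP[s0 s1] /=.
  rewrite u0v0 ?enorm_axis ?gtr0_norm //.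
  by rewrite /cl_uball /= enorm_axis gtr0_norm // ltW.
pose d := 1 - r0.
have d01 : 0 < d <= 1 by rewrite /d; lra.
have d4 : 1 / 4 <= d by rewrite /d; lra.
have xb : uball (r0 *: delta_mx 0 i0 : 'rV[R]_n).
  by rewrite /uball /= enorm_axis ger0_norm; lra.
have := continuous_at_uball u0 _ cu0 xb.
move=> /cvgr_gt/(_ A0).
have -> : u0 (r0 *: delta_mx 0 i0) = v0 r0.
  by rewrite u0v0 ?enorm_axis ?ger0_norm //; [lra|exact: ltW].
move=> /(_ big) /nbhs_ballP[eps /= eps0 Heps].
(* [eta] is such that the barrier is positive at time [0] only within
   distance [d m <= eps] of [x0]. *)
have [m [m0 m1 me]] : exists m : R, [/\ 0 < m, m <= 1 & m <= eps].
  exists (Num.min eps 1).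
  by rewrite lt_min eps0 ltr01 !ge_min !lexx orbT.
pose eta := T * m `^ b^-1.
have b01 : 0 < b <= 1 by lra.
have [b0 _] := andP b01.
have q1 : m `^ b^-1 <= 1.
  have : m `^ b^-1 <= 1 `^ b^-1.
    by apply: ge0_ler_powR; rewrite ?nnegrE ?invr_ge0 ?(ltW m0) ?(ltW b0).
  by rewrite powR1.
have q0 : 0 < m `^ b^-1 by rewrite powR_gt0.
have eta0 : 0 < eta by rewrite mulr_gt0.
have etaT : eta <= T by rewrite /eta ler_piMr // ltW.
pose kappa := 16 * (A0 * T `^ a).
have kap1 : 1 <= kappa.
  have : 1 <= A0 * T `^ a.
    rewrite -(powR_cancel T a T0) mulrC ler_wpM2r ?powR_ge0 // lerDl.
    by rewrite divr_ge0 ?(ltW a10) // mulr_ge0 // addr_ge0.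
  by rewrite /kappa; lra.
have kapd : A0 * T `^ a <= kappa * d ^+ 2.
  have : (1 / 4) ^+ 2 <= d ^+ 2 by rewrite ler_sqr ?nnegrE; lra.
  have AT : 0 <= A0 * T `^ a by rewrite mulr_ge0 ?powR_ge0 // ltW.
  move=> /(ler_wpM2l AT); rewrite /kappa; lra.
have v0E : vertex b d T 0 = r0.
  by rewrite /vertex subr0 -mulrA (mulrC (T `^ (- b))) powR_cancel // mulr1 /d; lra.
have low := barrier_le_solution lambda Lambda p a b d kappa A0
  (K * kappa + C + 1) eta T i0 u0 u.
have cu : {within @cl_cyl0 R n, continuous u} by case: usol.
have T01 : 0 < T <= 1 by lra.
suff : 0 < u (delta_mx 0 i0, T).
  rewrite lat ?ltxx //.
  by have := enorm_axis (n := n) i0 (1 : R); rewrite scale1r normr1.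
have A04 : 0 < A0 / 4 by rewrite divr_gt0.
apply: (boundary_value_gt0 u b d T (A0 / 4) i0) => // t t0T.
have near_x0 (x : 'rV[R]_n) : cl_uball x ->
    Num.sqrt (sqdist (vertex b d T) i0 (x, 0)) < d * T `^ (- b) * eta `^ b ->
    A0 <= u0 x.
  move=> xcb; have -> : d * T `^ (- b) * eta `^ b = d * m.
    rewrite /eta powRM ?(ltW T0) ?(ltW q0) // -powRrM mulVf ?gt_eqF //.
    rewrite powRr1 ?(ltW m0) // mulrA -(mulrA d) (mulrC (T `^ (- b))).
    by rewrite powR_cancel // mulr1.
  move=> sm; apply/ltW/Heps; split=> // i j; rewrite /ball /= !mxE ord1 distrC.
  have dm : d * m <= eps.
    have : d * m <= m by rewrite ler_piMl ?(ltW m0) //; case/andP: d01.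
    by move/le_trans; apply.
  apply: lt_le_trans dm; apply: le_lt_trans sm.
  rewrite -sqrtr_sqr ler_sqrt ?sqdist_ge0 // /sqdist (bigD1 j) //= v0E.
  by rewrite mulrC lerDl sumr_ge0 // => l _; exact: sqr_ge0.
have [] := low _ p2 a01 ap bap bb d01 kap1 eta0 T0 _ _ kapd u0_ge0 near_x0 usol
  lat t t0T.
- by rewrite lambda_gt0.
- by apply: le_trans T12; rewrite lerD2r.
- by rewrite -/K -/C -addrA ltrD2l ltrDl.
move=> vb hu; split=> //; apply: le_trans hu.
apply: height_ge; rewrite ?T0 ?eta0 //; last by rewrite KT.
by case/andP: T01.
Qed.
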